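(* Let $(Z_m)_{m\ge0}$ be the spider walk, and regard $Z_n$ as a complex-valued function on $\{-1,+1\}^n$. Then the sequence $\big(Z_n/\sqrt n\big)_{n=1}^\infty$ is not tree stable.
   Context: Spider walk. Let $\omega=e^{2\pi i/3}$ and $v_0=0$, $v_1=-1$, $v_2=\omega^2$, which are the vertices of an equilateral triangle with side $1$ satisfying $v_{j+1}=v_j-\omega^j$ for $j\in\{0,1,2\}$ (index $j+1$ taken mod $3$). The state space is the set of points $v_j+k\omega^j$ with $j\in\{0,1,2\}$ and $k\in\{0,1,2,\dots\}$ (these points are distinct): three rays attached to the central triangle, each ray prolonging one side of the triangle. For a state $z=v_j+k\omega^j$ put $e(z)=\omega^j$; from $z$ the walk moves to $z+e(z)$ or $z-e(z)$ with probability $1/2$ each (both are again states; from $v_j$ the move $-\omega^j$ leads to $v_{j+1}$). The walk starts at the origin: $Z_0=0$. The set of $n$-step trajectories is the set of leaves of an $n$-level binary tree and is identified with $\{-1,+1\}^n$ (with uniform measure) via $Z_m=Z_{m-1}+\tau_m e(Z_{m-1})$ for $m=1,\dots,n$; thus $Z_n=Z_n(\tau_1,\dots,\tau_n)$ is a function $\{-1,+1\}^n\to\mathbb{C}$, $(Z_m)$ is a complex-valued martingale with steps of length $1$, and $\mathbb{E}|Z_n|^2=n$. Norm and Fourier–Walsh expansion. For $f:\{-1,+1\}^n\to\mathbb{C}$ put $\|f\|^2=2^{-n}\sum_{\tau}|f(\tau)|^2$. Write $f(\tau)=\sum_{j=0}^n\tilde f_j(\tau)$, where $\tilde f_j(\tau)=\sum_{i_1<\dots<i_j}\hat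 f_j(i_1,\dots,i_j)\,\tau_{i_1}\cdots\tau_{i_j}$ is the degree-$j$ part of the Fourier–Walsh expansion of $f$. Put $S_m^\infty(f)=\sum_{i=m}^n\|\tilde f_i\|^2$. Cube stability. A sequence $F=(f_n)_{n=1}^\infty$, $f_n:\{-1,+1\}^n\to\mathbb{C}$, with $0<\liminf_n\|f_n\|\le\limsup_n\|f_n\|<\infty$, is cube stable if $S_m^\infty(F):=\limsup_{n\to\infty}S_m^\infty(f_n)\to0$ as $m\to\infty$. Tree automorphisms. A tree automorphism of $\{-1,+1\}^n$ is a map $A:\{-1,+1\}^n\to\{-1,+1\}^n$ of the form $$A(\tau_1,\dots,\tau_n)=\big(a()\tau_1,\ a(\tau_1)\tau_2,\ a(\tau_1,\tau_2)\tau_3,\ \dots,\ a(\tau_1,\dots,\tau_{n-1})\tau_n\big)$$ for an arbitrary function $a:\bigcup_{m=1}^n\{-1,+1\}^{m-1}\to\{-1,+1\}$. Tree stability. A sequence $(f_n)_{n=1}^\infty$ of functions $f_n:\{-1,+1\}^n\to\mathbb{C}$ is tree stable if there exist tree automorphisms $A_n:\{-1,+1\}^n\to\{-1,+1\}^n$ such that $(f_n\circ A_n)_{n=1}^\infty$ is cube stable. *)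

(* Defs.v *)
From HB Require Import structures.
From mathcomp Require Import all_boot all_order all_algebra.
From mathcomp Require Import complex.
From mathcomp Require Import all_classical all_reals all_analysis.
From mathcomp Require Import ring lra.

Set Implicit Arguments.
Unset Strict Implicit.
Unset Printing Implicit Defensive.

Import Order.TTheory GRing.Theory Num.Theory.
Import numFieldNormedType.Exports.

Local Open Scope classical_set_scope.
Local Open Scope ring_scope.
Local Open Scope complex_scope.

(* The cube {-1, +1}^n is encoded as n.-tuple bool: the boolean b stands for
   the sign (-1) ^+ b, so true is -1, false is +1 and the product of two signs
   is the exclusive or (+) of their codes. Positions are numbered from 0, i.e.,
   tau_m is tnth tau (m - 1). *)

Section CubeFunctions.
Variable R : realType.

Definition cube_norm n (f : n.-tuple bool -> R[i]) : R :=
  Num.sqrt ((2 ^+ n)^-1 * \sum_(tau : n.-tuple bool) (Normc.normc (f tau)) ^+ 2).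

Definition walsh n (A : {set 'I_n}) (tau : n.-tuple bool) : R[i] :=
  \prod_(i in A) (-1) ^+ tnth tau i.

(* The coefficient \hat f_j(i_1, ..., i_j), for A = {i_1 < ... < i_j}. *)
Definition fourier n (f : n.-tuple bool -> R[i]) (A : {set 'I_n}) : R[i] :=
  (2 ^+ n)^-1 * \sum_(tau : n.-tuple bool) f tau * walsh A tau.

Definition degree_part n (f : n.-tuple bool -> R[i]) (j : nat)
    (tau : n.-tuple bool) : R[i] :=
  \sum_(A : {set 'I_n} | #|A| == j) fourier f A * walsh A tau.

(* S_m^oo(f) *)
Definition spectral_tail n (m : nat) (f : n.-tuple bool -> R[i]) : R :=
  \sum_(m <= i < n.+1) cube_norm (degree_part f i) ^+ 2.

(* The sequences (f_n) also have a term f_0, on which the limits inferior and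
   superior, taken in \bar R, do not depend. *)
Definition cube_stable (f : forall n, n.-tuple bool -> R[i]) : Prop :=
  [/\ (0 < limn_einf (fun n => (cube_norm (f n))%:E))%E,
      (limn_esup (fun n => (cube_norm (f n))%:E) < +oo)%E &
      (fun m => limn_esup (fun n => (spectral_tail m (f n))%:E)) @ \oo
        --> 0%E].

(* The function a is only applied to the prefixes (tau_1, ..., tau_(m-1)) with
   m <= n, where it is arbitrary. *)
Definition tree_automorphism n (A : n.-tuple bool -> n.-tuple bool) : Prop :=
  exists a : seq bool -> bool, forall (tau : n.-tuple bool) (i : 'I_n),
    tnth (A tau) i = a (take i tau) (+) tnth tau i.

Definition tree_stable (f : forall n, n.-tuple bool -> R[i]) : Prop :=
  exists A : forall n, n.-tuple bool -> n.-tuple bool,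
    (forall n, tree_automorphism (A n)) /\
    cube_stable (fun n => f n \o A n).

End CubeFunctions.

Section SpiderWalk.
Variable R : realType.

(* e ^ (2 pi i / 3) *)
Definition omega : R[i] := cos (2 * pi / 3) +i* sin (2 * pi / 3).

Definition spider_vertex (j : 'I_3) : R[i] := [:: 0; -1; omega ^+ 2]`_j.

Definition spider_point (j : 'I_3) (k : nat) : R[i] :=
  spider_vertex j + k%:R * omega ^+ j.

(* The direction e(z) of a state z; see spider_dirE. It is 0 if z is not a
   state. *)
Definition spider_dir (z : R[i]) : R[i] :=
  xget 0 [set d | exists (j : 'I_3) (k : nat),
                    z = spider_point j k /\ d = omega ^+ j].

Definition spider_step (z : R[i]) (b : bool) : R[i] :=
  z + (-1) ^+ b * spider_dir z.

(* Z_n(tau_1, ..., tau_n) *)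
Definition spider_walk n (tau : n.-tuple bool) : R[i] :=
  foldl spider_step 0 tau.

End SpiderWalk.

Lemma omegaE (R : realType) : exists2 s : R, 0 < s & s ^+ 2 = 3 / 4 /\ omega R = (- 2^-1) +i* s.
Proof.
have pi0 := pi_gt0 R.
set x : R := 2 * pi / 3.
have s0 : 0 < sin x by apply: sin_gt0_pi; rewrite /x; apply/andP; split; lra.
have c0 : cos x < 0.
  have -> : x = (pi / 2) + (pi / 6) by rewrite /x; field.
  rewrite addrC cosDpihalf oppr_lt0; apply: sin_gt0_pi.
  by apply/andP; split; lra.
have e3 : sin (x + (x + x)) = 0.
  have -> : x + (x + x) = pi *+ 2 by rewrite /x; field.
  exact: sin2pi.
have cs := cos2Dsin2 x.
move: e3; rewrite !sinD !cosD => e3.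
have h : sin x * (3 * cos x ^+ 2 - sin x ^+ 2) = 0 by rewrite -[RHS]e3; ring.
have {}h : 3 * cos x ^+ 2 = sin x ^+ 2.
  by move/eqP: h; rewrite mulf_eq0 gt_eqF //= subr_eq0 => /eqP.
have c2 : (cos x - 2^-1) * (cos x + 2^-1) = 0 by nra.
have cE : cos x = - 2^-1.
  move/eqP: c2; rewrite mulf_eq0 => /orP[/eqP e|/eqP e]; last by lra.
  by move: c0; lra.
exists (sin x) => //; split; first by rewrite -h cE; field.
by rewrite /omega -/x cE.
Qed.

(* omega is a primitive cube root of unity, and v_(j+1) = v_j - omega ^ j. *)
Lemma omega2E (R : realType) : omega R ^+ 2 = - 1 - omega R.
Proof.
have [s s0 [s2 ->]] := omegaE R; rewrite expr2; apply/eqP.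
by rewrite eq_complex /=; apply/andP; split; apply/eqP; nra.
Qed.

Lemma spider_vertexS (R : realType) (j : 'I_3) :
  spider_vertex R (ordS j) = spider_vertex R j - omega R ^+ j.
Proof.
have w2 := omega2E R.
case: j => [[|[|[|//]]] j3]; rewrite /spider_vertex /= ?expr0 ?expr1.
- by rewrite sub0r.
- by rewrite w2.
- by rewrite subrr.
Qed.

Lemma spider_point_inj (R : realType) (j j' : 'I_3) (k k' : nat) :
  spider_point R j k = spider_point R j' k' -> j = j' /\ k = k'.
Proof.
have w2 := omega2E R; have [s s0 [s2 wE]] := omegaE R.
have natC (m : nat) : (m%:R : R[i]) = m%:R +i* 0.
  by rewrite -[RHS]/(m%:R%:C) rmorph_nat.
have k0 := ler0n R k; have k'0 := ler0n R k'.
have nat_inj : k%:R = k'%:R :> R -> k = k'.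
  by move=> /eqP; rewrite eqr_nat => /eqP.
case: j => [[|[|[|//]]] j3]; case: j' => [[|[|[|//]]] j'3];
  rewrite /spider_point /spider_vertex /= ?expr0 ?expr1 ?w2 ?wE !natC;
  move=> /eqP; rewrite eq_complex /= => /andP[/eqP re /eqP im];
  clear w2 wE natC; (try by exfalso; nra);
  by split; [exact: val_inj|apply: nat_inj; nra].
Qed.

Lemma spider_dirE (R : realType) (j : 'I_3) (k : nat) :
  spider_dir (spider_point R j k) = omega R ^+ j.
Proof.
rewrite /spider_dir; case: xgetP => [d -> [j' [k' [e ->]]]|].
  by have [-> _] := spider_point_inj e.
by move/(_ (omega R ^+ j)); case; exists j, k.
Qed.

Lemma spider_step_forth (R : realType) (j : 'I_3) (k : nat) :
  spider_step (spider_point R j k) false = spider_point R j k.+1.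
Proof.
by rewrite /spider_step spider_dirE /spider_point expr0 -natr1; ring.
Qed.

Lemma spider_step_back (R : realType) (j : 'I_3) (k : nat) :
  spider_step (spider_point R j k) true =
  if k is k'.+1 then spider_point R j k' else spider_point R (ordS j) 0.
Proof.
rewrite /spider_step spider_dirE expr1; case: k => [|k].
  by rewrite /spider_point spider_vertexS; ring.
by rewrite /spider_point -natr1; ring.
Qed.

Lemma spider_walk_rcons (R : realType) n (tau : n.-tuple bool) (b : bool) :
  spider_walk R [tuple of rcons tau b] = spider_step (spider_walk R tau) b.
Proof. by rewrite /spider_walk /= foldl_rcons. Qed.

Lemma sum_walsh (R : realType) n (s t : n.-tuple bool) :
  \sum_(A : {set 'I_n}) walsh R A s * walsh R A t = 2 ^+ n *+ (s == t).
Proof.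
transitivity (\prod_(i < n) (1 + (-1) ^+ (tnth s i (+) tnth t i) : R[i])).
  under [RHS]eq_bigr do rewrite addrC.
  rewrite bigA_distr; apply: eq_big => [A|A _]; first by rewrite inE.
  rewrite -big_mkcond -big_split /=.
  by apply: eq_bigr => i _; rewrite signr_addb.
have [->|st] := eqVneq s t.
  by under eq_bigr do rewrite addbb expr0; rewrite prodr_const card_ord.
have [i sti] : exists i, tnth s i != tnth t i.
  apply/existsP; apply: contraNT st; rewrite negb_exists => /forallP h.
  by apply/eqP/eq_from_tnth => i; apply/eqP/negPn/h.
rewrite (bigD1 i) //=; case: (tnth s i) (tnth t i) sti => [] [] // _;
  by rewrite addrN mul0r.
Qed.

Lemma sum_degree_part (R : realType) n (f : n.-tuple bool -> R[i])
    (tau : n.-tuple bool) :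
  f tau = \sum_(j < n.+1) degree_part f j tau.
Proof.
transitivity (\sum_(A : {set 'I_n}) fourier f A * walsh R A tau).
  under eq_bigr do rewrite /fourier -mulrA mulr_suml.
  rewrite -mulr_sumr exchange_big /=.
  under eq_bigr do (under eq_bigr do rewrite -mulrA; rewrite -mulr_sumr sum_walsh).
  rewrite (bigD1 tau) //= eqxx big1 => [|s /negPf ->]; last by rewrite mulr0.
  by rewrite addr0 mulrCA mulVf ?mulr1 // expf_neq0 // pnatr_eq0.
have cardP (A : {set 'I_n}) : (#|A| < n.+1)%N.
  by rewrite ltnS -[X in (_ <= X)%N]card_ord max_card.
rewrite (partition_big (fun A : {set 'I_n} => inord #|A| : 'I_n.+1) xpredT) //.
apply: eq_bigr => j _; apply: eq_bigl => A /=.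
by rewrite -val_eqE /= inordK // cardP.
Qed.

(* Main.v *)
Require Import Defs.
From mathcomp Require Import all_boot all_order all_algebra.
From mathcomp Require Import complex.
From mathcomp Require Import all_classical all_reals all_analysis.
From mathcomp Require Import ring lra zify.

Set Implicit Arguments.
Unset Strict Implicit.
Unset Printing Implicit Defensive.

Import Order.TTheory GRing.Theory Num.Theory.
Import numFieldNormedType.Exports.

Local Open Scope classical_set_scope.
Local Open Scope ring_scope.
Local Open Scope complex_scope.

(** The idea is that a small noise in the signs separates two copies of the
spider walk by a distance of order sqrt n, however small the noise is.

Let s and t be uniform points of the cube whose coordinates are pairwise
correlated: s_i t_i has mean rho, independently over i. Then
E |f(s) - f(t)|^2 = 2 sum_A (1 - rho ^ |A|) |f^(A)|^2, which is at most
2 m (1 - rho) ||f||^2 + 2 S_m(f) (noise_mean_sqr_dist_le). For a cube stable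
sequence this is as small as desired, for all large n, once m is large and rho
is close enough to 1. On the other hand, if f is Z_n / sqrt n composed with a
tree automorphism, this mean is at least 1 / 400 for all large n, whatever
rho in (0, 1) is (mean_sqr_dist_ge); the two facts are contradictory.

For the lower bound, a tree automorphism multiplies each sign by a factor that
depends on the past, hence s and t drive two spider walks Z, Z' whose signs,
given the past, have correlation rho or - rho. A function of the two
states with a nonnegative drift under every such correlation therefore has a
nondecreasing mean (submartingale_noise_mean). The drift of the graph distance
between Z and Z' is nonnegative as long as they are not both in the central
triangle. When Z is in the triangle and Z' is on a ray, two of the three rays
lead Z away from Z', and this makes the drift positive, up to a bounded
correction of the distance (separation_drift). So the mean distance is at least
of the order of the mean number of visits of Z to the triangle, which is of order
sqrt n (mean_height_ge), minus a constant multiple of the mean number of common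
visits.

Common visits are rare because rho < 1: the pair of heights (x, y) above the
triangle is a reflected planar walk with an elliptic covariance, which hits the
corner of the quadrant less often than a degenerate one. This is quantified by
the function (C + x^2 + y^2) ^ beta, where beta < 1/2 depends on rho. It has
nonnegative drift everywhere and positive drift at the corner
(corner_fun_exists), and its mean is only O(n ^ beta) = o(sqrt n). *)

(** * The spider walk and the separation of two states *)

(** The pair (j, k) stands for the point v_j + k omega^j. *)
Definition state := ('I_3 * nat)%type.

Definition origin : state := (ord0, 0%N).

Definition state_step (z : state) (b : bool) : state :=
  if b then (if z.2 is k.+1 then (z.1, k) else (ordS z.1, 0%N))
  else (z.1, z.2.+1).

Definition state_point (R : realType) (z : state) : R[i] :=
  spider_point R z.1 z.2.

Lemma state_pointS (R : realType) (z : state) (b : bool) :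
  spider_step (state_point R z) b = state_point R (state_step z b).
Proof.
case: z b => j k [|]; rewrite /state_point /=.
  by rewrite spider_step_back; case: k.
by rewrite spider_step_forth.
Qed.

Lemma foldl_state_point (R : realType) (s : seq bool) (z : state) :
  foldl (@spider_step R) (state_point R z) s =
  state_point R (foldl state_step z s).
Proof. by elim: s z => //= b s IH z; rewrite state_pointS IH. Qed.

(** The distance in the graph formed by the triangle and the three rays. *)
Definition graph_dist (z z' : state) : nat :=
  if z.1 == z'.1 then ((z.2 - z'.2) + (z'.2 - z.2))%N else (z.2 + z'.2).+1.

(** With one walk at the vertex j and the other one on the ray j', the graph distance
has drift 0, 1/2, 0 for j - j' = 0, 1, 2 mod 3. Adding a_(j - j') to it adds
a_(j - j' + 1) / 2 - a_(j - j') to the drift, because the walk in the triangle moves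
from j to j + 1 with probability 1/2. For a = (1/7, 3/7, 0) the three drifts become
equal to 1/14; multiplication by 7 makes everything an integer. *)
Definition vertex_bonus (j j' : 'I_3) : nat :=
  if j == j' then 1%N else if j == ordS j' then 3%N else 0%N.

(** The value is maximal when both states are in the triangle, so that the arrival of
the second one, while the first one stays, does not decrease it. *)
Definition bonus (z z' : state) : nat :=
  match z.2, z'.2 with
  | 0, 0 => 3%N
  | 0, _.+1 => vertex_bonus z.1 z'.1
  | _.+1, 0 => vertex_bonus z'.1 z.1
  | _.+1, _.+1 => 0%N
  end.

Definition separation (z z' : state) : nat :=
  (7 * graph_dist z z' + bonus z z')%N.

Definition central (z : state) : bool := z.2 == 0%N.

(** Two uniform signs of any correlation are a mixture of two equal signs (b = false)
and two opposite signs (b = true), so both drifts are bounded below. If exactly one state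
is in the triangle, the positive drift is that of the distance from it to the other,
spread over the vertices; if both are, a bounded loss is allowed. *)
Lemma separation_drift (z z' : state) (b : bool) :
  (2 * separation z z' + central z + central z' <=
   separation (state_step z false) (state_step z' b) +
   separation (state_step z true) (state_step z' (~~ b)) +
   22 * (central z && central z'))%N.
Proof.
case: z => [[[|[|[|//]]] ?] [|[|k]]]; case: z' => [[[|[|[|//]]] ?] [|[|k']]];
  case: b; rewrite /separation /graph_dist /bonus /vertex_bonus /central /=
    -?val_eqE /=; lia.
Qed.

Lemma bonus_le (z z' : state) : (bonus z z' <= 3)%N.
Proof.
by case: z z' => [j [|k]] [j' [|k']]; rewrite /bonus /vertex_bonus //=;
  do 2?case: ifP.
Qed.

(** On different rays, the squared Euclidean distance has the form a^2 + a b + b^2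
where a + b is the graph distance, and it is at least 3/4 (a + b)^2. *)
Lemma graph_dist_le_norm (R : realType) (z z' : state) :
  (graph_dist z z')%:R ^+ 2 <=
    4 / 3 * Normc.normc (state_point R z - state_point R z') ^+ 2.
Proof.
have w2 := omega2E R; have [s s0 [s2 wE]] := omegaE R.
have natC (m : nat) : (m%:R : R[i]) = m%:R +i* 0.
  by rewrite -[RHS]/(m%:R%:C) rmorph_nat.
have normE (x y : R) : Normc.normc (x +i* y) ^+ 2 = x ^+ 2 + y ^+ 2.
  by rewrite /Normc.normc sqr_sqrtr // addr_ge0 ?sqr_ge0.
case: z => [j k]; case: z' => [j' k'].
have k0 := ler0n R k; have k'0 := ler0n R k'.
have dE : ((k - k') + (k' - k))%:R ^+ 2 = (k%:R - k'%:R) ^+ 2 :> R.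
  have [kk'|/ltnW kk'] := leqP k k'.
    rewrite (eqP kk') add0n natrB //; ring.
  by rewrite [(k' - k)%N](eqP kk') addn0 natrB.
rewrite /state_point /graph_dist.
case: j => [[|[|[|//]]] j3]; case: j' => [[|[|[|//]]] j'3];
  rewrite /= -?val_eqE /= /spider_point /spider_vertex /= ?expr0 ?expr1 ?w2 ?wE;
  rewrite !natC ?dE -?[X in X%:R]addn1 ?natrD.
all: rewrite /=; simpc; rewrite ?normE.
all: have ss (x y : R) : (x * s) * (y * s) = 3 / 4 * (x * y)
  by rewrite -s2; ring.
all: have := sqr_ge0 (k%:R - k'%:R : R); have := sqr_ge0 (k%:R - k'%:R + 1 : R);
  have := sqr_ge0 (k%:R - k'%:R - 1 : R);
  have := ss k%:R k%:R; have := ss k%:R k'%:R; have := ss k'%:R k'%:R;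
  have := ss 1 k%:R; have := ss 1 k'%:R; have := ss 1 1; clear; lra.
Qed.

(** * Second-order lower bound for powers *)

(** With m = w ^ a, both 1 / m and w / m are bounded below by 1 + ln, and the convex
combination of the two bounds with weights 1 - a and a is 1. *)
Lemma powR_bernoulli (R : realType) (a w : R) : 0 <= a <= 1 -> 0 < w ->
  w `^ a <= 1 + a * (w - 1).
Proof.
move=> /andP[a0 a1] w0.
have m0 := powR_gt0 a w0; set m := w `^ a in m0 *.
have h1 : 1 + ln m^-1 <= m^-1.
  have := @expR_ge1Dx R (ln m^-1); rewrite lnK // posrE invr_gt0 //.
have h2 : 1 + ln (w / m) <= w / m.
  have := @expR_ge1Dx R (ln (w / m)); rewrite lnK // posrE divr_gt0 //.
have lm : ln m = a * ln w by rewrite /m ln_powR.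
rewrite lnV ?posrE // in h1.
rewrite ln_div ?posrE // in h2.
have h3 : 1 <= (1 - a) * m^-1 + a * (w / m).
  have e1 : (1 - a) * (1 - ln m) <= (1 - a) * m^-1.
    by apply: ler_wpM2l => //; lra.
  have e2 : a * (1 + (ln w - ln m)) <= a * (w / m) by apply: ler_wpM2l.
  apply: le_trans (lerD e1 e2); rewrite lm; nra.
have : m * 1 <= m * ((1 - a) * m^-1 + a * (w / m)) by rewrite ler_pM2l.
rewrite mulr1; move/le_trans; apply.
suff -> : m * ((1 - a) * m^-1 + a * (w / m)) = 1 + a * (w - 1) by [].
by field; rewrite gt_eqF.
Qed.

(** The second derivative of (1 + t) ^ a tends to - a (1 - a) as t tends to 0; for
t >= - tau the loss in the constant is the factor 1 / (1 - tau). The difference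
of the two sides has its minimum at t = 0, since Bernoulli's inequality gives the
sign of its derivative. *)
Lemma powR_taylor2 (R : realType) (a tau t : R) :
    0 < a < 1 -> 0 <= tau < 1 -> - tau <= t ->
  1 + a * t - a * (1 - a) / 2 / (1 - tau) * t ^+ 2 <= (1 + t) `^ a.
Proof.
move=> /andP[a0 a1] /andP[tau0 tau1] tau_t.
set c := a * (1 - a) / (1 - tau).
pose g (s : R) : R := s `^ a - a * s + c / 2 * (s - 1) ^+ 2.
have dg (s : R) : 0 < s ->
    is_derive s 1 g (a * s `^ (a - 1) - a + c * (s - 1)).
  move=> s0; have := is_derive1_powR a s0 => h.
  apply: is_derive_eq.
  rewrite -![_ *: _]/(_ * _). by field.
have g1s (s : R) : 0 < s -> g^`()%classic s = a * s `^ (a - 1) - a + c * (s - 1).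
  by move=> s0; have h := dg s s0; rewrite derive1E derive_val.
have dbl (s : R) : 0 < s -> derivable g s 1 by move=> s0; have h := dg s s0.
have cg (x y : R) : 0 < x -> {within `[x, y], continuous g}.
  move=> x0; apply: derivable_within_continuous => s.
  rewrite in_itv /= => /andP[xs _]; apply: dbl; exact: lt_le_trans xs.
have pinv (s : R) : 0 < s -> s `^ (a - 1) = (s^-1) `^ (1 - a).
  by move=> s0; rewrite -powR_inv1 ?ltW // -powRrM; congr powR; ring.
have c0 : a * (1 - a) <= c.
  rewrite /c ler_pdivlMr; last by lra.
  have : 0 <= a * (1 - a) * tau by rewrite !mulr_ge0 //; lra.
  lra.
suff: g 1 <= g (1 + t).
  rewrite /g powR1 [1 + t - 1]addrAC subrr add0r expr0n /= mulr0 addr0.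
  rewrite [a * (1 - a) / 2 / _](_ : _ = c / 2); last by rewrite /c; ring.
  lra.
have [t0|/ltW t0] := leP 0 t.
  apply: (@ger0_derive1_le_cc _ g 1 (1 + t)).
  - by move=> s; rewrite in_itv /= => /andP[s1 _]; apply: dbl; lra.
  - move=> s; rewrite in_itv /= => /andP[s1 _].
    have s0 : 0 < s by lra.
    rewrite g1s //.
    have b := @powR_bernoulli R (1 - a) s ltac:(lra) s0.
    have p0 := powR_gt0 (a - 1) s0.
    have pq : s `^ (a - 1) * s `^ (1 - a) = 1.
      have e : a - 1 + (1 - a) = 0 by ring.
      by rewrite -powRD e ?powRr0 // (gt_eqF s0) implybT.
    have h : 1 - (1 - a) * (s - 1) <= s `^ (a - 1).
      have : s `^ (a - 1) * s `^ (1 - a) <= s `^ (a - 1) * (1 + (1 - a) * (s - 1)).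
        by rewrite ler_pM2l.
      have : 0 <= (1 - a) * (s - 1) by rewrite mulr_ge0 //; lra.
      rewrite pq; nra.
    have : a * (1 - (1 - a) * (s - 1)) <= a * s `^ (a - 1) by rewrite ler_pM2l.
    have : a * (1 - a) * (s - 1) <= c * (s - 1) by rewrite ler_pM2r //; lra.
    lra.
  - by apply: cg.
  - by rewrite in_itv /=; lra.
  - by rewrite in_itv /=; lra.
  - by lra.
apply: (@ler0_derive1_le_cc _ g (1 + t) 1).
- by move=> s; rewrite in_itv /= => /andP[s1 _]; apply: dbl; lra.
- move=> s; rewrite in_itv /= => /andP[s1 s2].
  have s0 : 0 < s by lra.
  rewrite g1s // pinv //.
  have i0 : 0 < s^-1 by rewrite invr_gt0.
  have b := @powR_bernoulli R (1 - a) s^-1 ltac:(lra) i0.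
  have h : s^-1 - 1 <= (1 - s) / (1 - tau).
    rewrite ler_pdivlMr; last by lra.
    rewrite (_ : s^-1 - 1 = (1 - s) / s); last by field; rewrite gt_eqF.
    rewrite -mulrA ger_pMr; last by lra.
    by rewrite ler_pdivrMl //; lra.
  have : (1 - a) * (s^-1 - 1) <= (1 - a) * ((1 - s) / (1 - tau)).
    by rewrite ler_pM2l //; lra.
  move/(le_trans (y := _)) => /(_ _ (lexx _)) h2.
  have : a * (s^-1) `^ (1 - a) <= a * (1 + (1 - a) * ((1 - s) / (1 - tau))).
    by rewrite ler_pM2l //; lra.
  rewrite (_ : c * (s - 1) = - (a * ((1 - a) * ((1 - s) / (1 - tau))))); last first.
    by rewrite /c; ring.
  lra.
- by apply: cg; lra.
- by rewrite in_itv /=; lra.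
- by rewrite in_itv /=; lra.
- by lra.
Qed.

(** * A function that detects common visits to the triangle *)

(** The mean after one step of both walks, with signs of correlation c. *)
Definition step_mean (R : realType) (c : R) (Phi : state -> state -> R)
    (z z' : state) : R :=
  (1 + c) / 4 * (Phi (state_step z false) (state_step z' false) +
                 Phi (state_step z true) (state_step z' true)) +
  (1 - c) / 4 * (Phi (state_step z false) (state_step z' true) +
                 Phi (state_step z true) (state_step z' false)).

(** The shift by 1/2 makes the height the absolute value of a simple random walk on
the half-integers: from 1/2 the walk goes to 3/2 or to |- 1/2|. *)
Definition height (R : realType) (z : state) : R := z.2%:R + 2^-1.

Lemma height_gt0 (R : realType) (z : state) : 0 < height R z.
Proof. by have := ler0n R z.2; rewrite /height; lra. Qed.

Lemma sqr_heightS (R : realType) (z : state) (b : bool) :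
  height R (state_step z b) ^+ 2 = (height R z + (-1) ^+ b) ^+ 2.
Proof.
case: z b => j [|k] []; rewrite /height /= ?expr0 ?expr1 -?natr1; by field.
Qed.

Definition quad_pow (R : realType) (C beta x y : R) : R :=
  (C + x ^+ 2 + y ^+ 2) `^ beta.

Definition corner_fun (R : realType) (C beta : R) (z z' : state) : R :=
  quad_pow C beta (height R z) (height R z').

(** The increment v of the quadratic form w has mean 2 and second moment
4 + 4 (x^2 + y^2 + 2 c x y) <= 4 (1 + rho) w. The lower bound on C ensures
v >= - tau w, so that the second-order expansion of w ^ beta applies. As
1 + rho < 2, the last factor is positive for beta close to 1/2 and tau close to 0. *)
Lemma powR_quadratic_drift (R : realType) (rho beta tau C c x y : R) :
    0 < beta < 1 -> 0 < tau < 1 -> 2 / tau ^+ 2 <= C ->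
    - rho <= c <= rho -> 0 <= rho <= 1 ->
  quad_pow C beta x y + quad_pow C beta x y *
    (2 * beta / (C + x ^+ 2 + y ^+ 2) *
      (1 - (1 - beta) * (1 + rho) / (1 - tau))) <=
  (1 + c) / 4 * (quad_pow C beta (x + 1) (y + 1) +
                 quad_pow C beta (x - 1) (y - 1)) +
  (1 - c) / 4 * (quad_pow C beta (x + 1) (y - 1) +
                 quad_pow C beta (x - 1) (y + 1)).
Proof.
move=> /andP[b0 b1] /andP[t0 t1] Ct /andP[rc cr] /andP[r0 r1].
set w := C + x ^+ 2 + y ^+ 2; pose F s s' := quad_pow C beta (x + s) (y + s').
rewrite {1 2}/quad_pow -/w.
have tC : 2 * tau^-1 <= tau * C.
  move: (Ct); rewrite ler_pdivrMr ?exprn_gt0 // => ?.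
  by rewrite ler_pdivrMr // mulrAC -expr2 mulrC.
have C0 : 0 <= C by apply: le_trans Ct; rewrite divr_ge0 // exprn_ge0 // ltW.
have C1 : 1 <= C.
  have : tau * C <= C by rewrite ler_piMl // ltW.
  have : 1 <= tau^-1 by rewrite invf_ge1 // ltW.
  lra.
have x2 := sqr_ge0 x; have y2 := sqr_ge0 y.
have w0 : 0 < w by rewrite /w; lra.
have wn := lt0r_neq0 w0.
have wb0 := powR_gt0 beta w0.
set g := beta * (1 - beta) / 2 / (1 - tau).
have g0 : 0 <= g by rewrite /g !divr_ge0 ?mulr_ge0 //; lra.
pose v s s' := 2 + 2 * (s * x + s' * y).
have Fge s s' : s ^+ 2 = 1 -> s' ^+ 2 = 1 ->
    w `^ beta * (1 + beta * (v s s' / w) - g * (v s s' / w) ^+ 2) <= F s s'.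
  move=> s1 s'1.
  have wv : C + (x + s) ^+ 2 + (y + s') ^+ 2 = w * (1 + v s s' / w).
    rewrite mulrDr mulr1 mulrCA divff // /v /w !sqrrD s1 s'1; ring.
  have wv0 : 0 <= 1 + v s s' / w.
    rewrite -(pmulr_rge0 _ w0) -wv.
    by have := sqr_ge0 (x + s); have := sqr_ge0 (y + s'); lra.
  rewrite /F /quad_pow wv powRM ?(ltW w0) // ler_pM2l //.
  apply: (powR_taylor2 (tau := tau)); [lra|lra|].
  rewrite ler_pdivlMr // mulNr lerNl.
  (* Young's inequality bounds the linear part of v by the quadratic form *)
  have h (z e : R) : e ^+ 2 = 1 -> - 2 * (e * z) <= tau * z ^+ 2 + tau^-1.
    move=> e1; have := sqr_ge0 (tau * z + e).
    have -> : (tau * z + e) ^+ 2 = tau * (tau * z ^+ 2 + tau^-1 + 2 * (e * z)).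
      rewrite !mulrDr divff ?gt_eqF // sqrrD e1; ring.
    by rewrite pmulr_rge0 //; lra.
  have h1 := h x s s1; have h2 := h y s' s'1.
  rewrite /v /w; lra.
have sq1 : 1 ^+ 2 = 1 :> R by rewrite expr1n.
have sqN1 : (- 1) ^+ 2 = 1 :> R by rewrite sqrrN expr1n.
have F1 := Fge 1 1 sq1 sq1; have F2 := Fge _ _ sqN1 sqN1.
have F3 := Fge _ _ sq1 sqN1; have F4 := Fge _ _ sqN1 sq1.
have p0 : 0 <= (1 + c) / 4 by rewrite divr_ge0 //; lra.
have q0 : 0 <= (1 - c) / 4 by rewrite divr_ge0 //; lra.
have := lerD (ler_wpM2l p0 (lerD F1 F2)) (ler_wpM2l q0 (lerD F3 F4)).
apply: le_trans; rewrite -!mulrDr !(mulrCA (_ / 4)) -!mulrDr.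
rewrite -[X in X + _ <= _]mulr1 -mulrDr ler_pM2l //.
set u := x ^+ 2 + y ^+ 2.
(* the second moment of the increment of the quadratic form *)
have m2 : 1 + u + 2 * c * (x * y) <= (1 + rho) * w.
  have : c * (2 * (x * y)) <= rho * u.
    have xy1 : 2 * (x * y) <= u by have := sqr_ge0 (x - y); rewrite /u; lra.
    have xy2 : - u <= 2 * (x * y) by have := sqr_ge0 (x + y); rewrite /u; lra.
    have u0 : 0 <= u by rewrite /u; lra.
    nra.
  have : rho * 1 <= rho * C by apply: ler_wpM2l.
  rewrite /w /u; lra.
set W := w^-1.
have W0 : 0 < W by rewrite invr_gt0.
have {}m2 : W * (1 + u + 2 * c * (x * y)) <= 1 + rho.
  by rewrite mulrC ler_pdivrMr.
have : g * 4 * W * (W * (1 + u + 2 * c * (x * y))) <= g * 4 * W * (1 + rho).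
  apply: ler_wpM2l => //; apply: mulr_ge0 (ltW W0); apply: mulr_ge0 => //.
have -> : g * 4 * W * (1 + rho) = 2 * beta * W * ((1 - beta) * (1 + rho) / (1 - tau)).
  by rewrite /g; field; lra.
rewrite /v /u; lra.
Qed.

(** With d = 1 - rho, the choice beta = 1/2 - d/8 and tau = d/8 gives
(1 - beta) (1 + rho) <= 1 - d/4 < 1 - tau, so that the drift is positive. *)
Lemma corner_fun_exists (R : realType) (rho : R) : 0 < rho < 1 ->
  exists C beta kappa : R, [/\ 0 < C, 0 < beta < 2^-1, 0 < kappa &
    forall c z z', - rho <= c <= rho ->
      corner_fun C beta z z' + kappa * (central z && central z')%:R <=
      step_mean c (corner_fun C beta) z z'].
Proof.
move=> /andP[r0 r1].
set d := 1 - rho; have d0 : 0 < d by rewrite /d; lra.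
have d1 : d < 1 by rewrite /d; lra.
set tau := d / 8; set beta := 2^-1 - d / 8; set C := 2 / tau ^+ 2.
have t0 : 0 < tau by rewrite divr_gt0.
have t1 : tau < 1 by rewrite /tau; lra.
have b0 : 0 < beta < 1 by rewrite /beta; lra.
have C0 : 0 < C by rewrite divr_gt0 // exprn_gt0.
set k0 := 1 - (1 - beta) * (1 + rho) / (1 - tau).
have k00 : 0 < k0.
  rewrite /k0 subr_gt0 ltr_pdivrMr; last lra.
  have -> : rho = 1 - d by rewrite /d; ring.
  by rewrite /beta /tau; nra.
have C20 : 0 < C + 2^-1 by lra.
exists C, beta, ((C + 2^-1) `^ beta * (2 * beta / (C + 2^-1) * k0)).
split=> //.
- by rewrite /beta; lra.
- rewrite mulr_gt0 ?powR_gt0 // mulr_gt0 // divr_gt0 //; lra.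
move=> c z z' crho.
have tt : 0 < tau < 1 by rewrite t0.
have rr : 0 <= rho <= 1 by lra.
have := powR_quadratic_drift (height R z) (height R z') b0 tt (lexx C) crho rr.
rewrite -/k0.
have sE (f f' : bool) : corner_fun C beta (state_step z f) (state_step z' f') =
    quad_pow C beta (height R z + (-1) ^+ f) (height R z' + (-1) ^+ f').
  by rewrite /corner_fun /quad_pow !sqr_heightS.
rewrite /step_mean !sE expr0 expr1.
apply: le_trans; rewrite lerD2l.
have [|_] := boolP (central z && central z'); last first.
  rewrite mulr0 /quad_pow !mulr_ge0 ?powR_ge0 ?invr_ge0 ?ltW //; first lra.
  by have := sqr_ge0 (height R z); have := sqr_ge0 (height R z'); lra.
rewrite /central /height /quad_pow => /andP[/eqP-> /eqP->].
rewrite mulr1 add0r.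
by have -> : C + 2^-1 ^+ 2 + 2^-1 ^+ 2 = C + 2^-1 by field.
Qed.

(** * Noise on the cube and pairs of coupled walks *)

(** The law of two points of the cube for which the pairs (s_i, t_i) are independent,
each with uniform marginals and E s_i t_i = rho. *)
Definition noise_weight (R : realType) (rho : R) n (s t : n.-tuple bool) : R :=
  \prod_(i < n) ((1 + rho * (-1) ^+ (tnth s i (+) tnth t i)) / 4).

Definition noise_mean (R : realType) (rho : R) n
    (g : n.-tuple bool -> n.-tuple bool -> R) : R :=
  \sum_(s : n.-tuple bool) \sum_(t : n.-tuple bool) noise_weight rho s t * g s t.

Lemma noise_mean_le (R : realType) (rho : R) n
    (g h : n.-tuple bool -> n.-tuple bool -> R) : -1 <= rho <= 1 ->
  (forall s t, g s t <= h s t) -> noise_mean rho g <= noise_mean rho h.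
Proof.
move=> r1 gh; apply: ler_sum => s _; apply: ler_sum => t _.
rewrite ler_wpM2l // prodr_ge0 // => i _.
by case: (_ (+) _); rewrite ?expr0 ?expr1; lra.
Qed.

Lemma noise_meanD (R : realType) (rho : R) n
    (g h : n.-tuple bool -> n.-tuple bool -> R) :
  noise_mean rho (fun s t => g s t + h s t) = noise_mean rho g + noise_mean rho h.
Proof.
rewrite -big_split; apply: eq_bigr => s _; rewrite -big_split.
by apply: eq_bigr => t _; rewrite mulrDr.
Qed.

Lemma noise_meanZ (R : realType) (rho c : R) n
    (g : n.-tuple bool -> n.-tuple bool -> R) :
  noise_mean rho (fun s t => c * g s t) = c * noise_mean rho g.
Proof.
rewrite mulr_sumr; apply: eq_bigr => s _; rewrite mulr_sumr.
by apply: eq_bigr => t _; rewrite mulrCA.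
Qed.

Lemma big_tuple_cons (V : nmodType) n (G : n.+1.-tuple bool -> V) :
  \sum_(s : n.+1.-tuple bool) G s =
  \sum_(b : bool) \sum_(s : n.-tuple bool) G [tuple of b :: s].
Proof.
rewrite pair_bigA /=.
rewrite (reindex (fun p : bool * n.-tuple bool => [tuple of p.1 :: p.2])) //=.
exists (fun s => (thead s, [tuple of behead s])) => [[b s] _|s _] /=.
  by rewrite theadE; congr pair; apply: val_inj.
by rewrite -tuple_eta.
Qed.

Lemma noise_mean_cons (R : realType) (rho : R) n
    (g : n.+1.-tuple bool -> n.+1.-tuple bool -> R) :
  noise_mean rho g =
  \sum_(b : bool) \sum_(b' : bool) (1 + rho * (-1) ^+ (b (+) b')) / 4 *
    noise_mean rho (fun s t => g [tuple of b :: s] [tuple of b' :: t]).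
Proof.
rewrite /noise_mean big_tuple_cons; apply: eq_bigr => b _.
under eq_bigr do rewrite big_tuple_cons.
rewrite exchange_big; apply: eq_bigr => b' _.
rewrite mulr_sumr; apply: eq_bigr => s _; rewrite mulr_sumr.
apply: eq_bigr => t _; rewrite mulrA; congr (_ * _).
rewrite /noise_weight big_ord_recl !tnth0; congr (_ * _).
by apply: eq_bigr => i _; rewrite !tnthS.
Qed.

(** A tree automorphism as a map on sequences of all lengths. After the first sign,
the rest of the sequence undergoes the automorphism of a subtree. *)
Fixpoint twist (a : seq bool -> bool) (s : seq bool) : seq bool :=
  if s is b :: s' then (a [::] (+) b) :: twist (fun p => a (b :: p)) s'
  else [::].

Lemma size_twist a s : size (twist a s) = size s.
Proof. by elim: s a => //= b s IH a; rewrite IH. Qed.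

Lemma nth_twist a s i : (i < size s)%N ->
  nth false (twist a s) i = a (take i s) (+) nth false s i.
Proof.
elim: s a i => // b s IH a [|i] //= i_s; by rewrite IH.
Qed.

Lemma tree_automorphism_twist n (A : n.-tuple bool -> n.-tuple bool) :
  tree_automorphism A -> exists a, forall tau, A tau = twist a tau :> seq bool.
Proof.
case=> a Aa; exists a => tau.
apply: (@eq_from_nth _ false) => [|i]; first by rewrite size_twist !size_tuple.
rewrite size_tuple => i_n; rewrite nth_twist ?size_tuple //.
by have := Aa tau (Ordinal i_n); rewrite !(tnth_nth false).
Qed.

(** The automorphism replaces the pair of signs (s_m, t_m), of correlation rho, by a
pair of correlation rho or - rho according to the past. The automorphisms a and a'
and the starting states differ for the two walks because, after one step, the
induction hypothesis is needed for two different subtrees. *)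
Lemma submartingale_noise_mean (R : realType) (rho : R)
    (Phi : nat -> state -> state -> R) : 0 <= rho <= 1 ->
  (forall m c z z', - rho <= c <= rho ->
     Phi m z z' <= step_mean c (Phi m.+1) z z') ->
  forall n m a a' z z',
    Phi m z z' <= noise_mean rho (fun s t : n.-tuple bool =>
      Phi (m + n)%N (foldl state_step z (twist a s))
                    (foldl state_step z' (twist a' t))).
Proof.
move=> /andP[r0 r1] Phi_le; elim=> [|n IH] m a a' z z'.
  have t0 (s : 0.-tuple bool) : xpredT s = pred1 [tuple] s.
    by rewrite (tuple0 s) /= eqxx.
  by rewrite /noise_mean !(big_pred1 _ t0) /noise_weight big_ord0 mul1r addn0.
rewrite noise_mean_cons.
apply: (@le_trans _ _ (\sum_(b : bool) \sum_(b' : bool)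
   (1 + rho * (-1) ^+ (b (+) b')) / 4 *
   Phi m.+1 (state_step z (a [::] (+) b)) (state_step z' (a' [::] (+) b')))).
  have rr : - rho <= rho <= rho by lra.
  have rN : - rho <= - rho <= rho by lra.
  have := Phi_le m _ z z' rr; have := Phi_le m _ z z' rN; rewrite /step_mean.
  rewrite !big_bool.
  by case: (a _) (a' _) => [] [] /=; rewrite ?expr0 ?expr1; lra.
apply: ler_sum => b _; apply: ler_sum => b' _.
apply: ler_wpM2l; first by case: (_ (+) _); rewrite ?expr0 ?expr1; lra.
rewrite -addSnnS; exact: IH.
Qed.

(** * Moments of the heights *)

Definition walk_mean (R : realType) (rho : R) n (a : seq bool -> bool)
    (Phi : state -> state -> R) : R :=
  noise_mean rho (fun s t : n.-tuple bool =>
    Phi (foldl state_step origin (twist a s))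
        (foldl state_step origin (twist a t))).

Lemma submartingale_walk_mean (R : realType) (rho : R) n a
    (Phi : nat -> state -> state -> R) : 0 <= rho <= 1 ->
  (forall m c z z', - rho <= c <= rho ->
     Phi m z z' <= step_mean c (Phi m.+1) z z') ->
  Phi 0%N origin origin <= walk_mean rho n a (Phi n).
Proof.
by move=> r01 /(submartingale_noise_mean r01) /(_ n 0%N a a origin origin).
Qed.

Lemma walk_meanD (R : realType) (rho : R) n a (Phi Psi : state -> state -> R) :
  walk_mean rho n a (fun z z' => Phi z z' + Psi z z') =
  walk_mean rho n a Phi + walk_mean rho n a Psi.
Proof. exact: noise_meanD. Qed.

Lemma walk_meanZ (R : realType) (rho c : R) n a (Phi : state -> state -> R) :
  walk_mean rho n a (fun z z' => c * Phi z z') = c * walk_mean rho n a Phi.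
Proof. exact: noise_meanZ. Qed.

Lemma walk_mean_le (R : realType) (rho : R) n a (Phi Psi : state -> state -> R) :
  0 <= rho <= 1 -> (forall z z', Phi z z' <= Psi z z') ->
  walk_mean rho n a Phi <= walk_mean rho n a Psi.
Proof. by move=> r01 le; apply: noise_mean_le => //; lra. Qed.

Lemma walk_mean_cst (R : realType) (rho c : R) n a : 0 <= rho <= 1 ->
  walk_mean rho n a (fun _ _ => c) = c.
Proof.
move=> r01; apply/le_anti/andP; split; last first.
  apply: (@submartingale_walk_mean _ _ _ _ (fun _ _ _ => c)) => // *.
  by rewrite /step_mean; lra.
have := @submartingale_walk_mean R rho n a (fun _ _ _ => - 1 * c) r01.
rewrite walk_meanZ => h; suff: - 1 * c <= - 1 * walk_mean rho n a (fun=> fun=> c) by lra.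
by apply: h => *; rewrite /step_mean; lra.
Qed.

Lemma step_mean_add (R : realType) (c : R) (f : state -> R) z z' :
  step_mean c (fun z z' => f z + f z') z z' =
  (f (state_step z false) + f (state_step z true)) / 2 +
  (f (state_step z' false) + f (state_step z' true)) / 2.
Proof. by rewrite /step_mean; field. Qed.

Lemma mean_sqr_height_le (R : realType) (rho : R) n a : 0 <= rho <= 1 ->
  walk_mean rho n a (fun z z' => height R z ^+ 2 + height R z' ^+ 2) <=
  2 * n%:R + 2^-1.
Proof.
move=> r01.
pose f m z : R := (- 1) * height R z ^+ 2 + m%:R.
have := @submartingale_walk_mean R rho n a (fun m z z' => f m z + f m z') r01.
have -> : walk_mean rho n a (fun z z' => f n z + f n z') =
    walk_mean rho n a (fun z z' =>
      - 1 * (height R z ^+ 2 + height R z' ^+ 2) + 2 * n%:R).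
  by congr walk_mean; apply/funext => z; apply/funext => z'; rewrite /f; ring.
rewrite walk_meanD walk_meanZ walk_mean_cst // => h.
suff : f 0%N origin + f 0%N origin <=
   -1 * walk_mean rho n a (fun z z' => height R z ^+ 2 + height R z' ^+ 2) + 2 * n%:R.
  rewrite /f /height /=; lra.
apply: h => m c z z' _.
rewrite step_mean_add /f !sqr_heightS expr0 expr1 -natr1; lra.
Qed.

(** The inequality t >= t^2 - t^4/4 for t >= 0, at t = x / (2 sqrt n), reduces a first
moment to the second and the fourth ones, which are known exactly: x^2 - m and
x^4 - 6 m x^2 + 3 m^2 + 2 m are martingales. *)
Lemma mean_height_ge (R : realType) (rho r : R) n a : 0 <= rho <= 1 ->
  1 <= r -> r ^+ 2 = n%:R ->
  4 / 5 * r <= walk_mean rho n a (fun z z' => height R z + height R z').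
Proof.
move=> r01 r1 rn; have r0 : 0 < r by lra.
have rV0 : 0 < r^-1 by rewrite invr_gt0.
set ri := r^-1 in rV0.
have rV1 : ri <= 1 by rewrite invf_le1.
have rV : r * ri = 1 by rewrite divff ?gt_eqF.
(* the mean, j steps ahead, of x^2 / (2 r) - x^4 / (32 r^3), given x^2 = q *)
pose g (j q : R) : R := (q + j) * ri / 2 -
  (q ^+ 2 + 6 * j * q + 3 * j ^+ 2 - 2 * j) * ri ^+ 3 / 32.
pose f m z : R := g (n%:R - m%:R) (height R z ^+ 2).
have := @submartingale_walk_mean R rho n a (fun m z z' => f m z + f m z') r01.
have e1 : r ^+ 2 * ri = r by rewrite expr2 -mulrA rV mulr1.
have e2 : r ^+ 4 * ri ^+ 3 = r.
  by rewrite -[RHS]mulr1 -(expr1n _ 3) -rV; ring.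
move=> h; apply: (@le_trans _ _ (f 0%N origin + f 0%N origin)).
  rewrite /f /g -rn /height /=.
  have e3 : r ^+ 2 * ri ^+ 3 = ri.
    by rewrite -[RHS]mulr1 -(expr1n _ 2) -rV; ring.
  have e4 : ri ^+ 3 <= ri by have := @exprn_ile1 _ 2 _ (ltW rV0) rV1; nra.
  lra.
apply: le_trans (h _) _.
  move=> m c z z' _; rewrite step_mean_add /f !sqr_heightS expr0 expr1 -natr1 /g.
  lra.
apply: walk_mean_le => // z z'.
suff fle (y : state) : f n y <= height R y by apply: lerD.
rewrite /f subrr /g.
have x0 := height_gt0 R y; set x := height R y in x0 *.
set t := x * ri / 2.
have xE : x = r * (2 * t).
  have : x * (r * ri) = x by rewrite rV mulr1.
  rewrite /t; lra.
have t0 : 0 < t by rewrite /t; apply: divr_gt0 => //; exact: mulr_gt0.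
rewrite xE [leLHS](_ : _ = r ^+ 2 * ri * (2 * t ^+ 2) -
  r ^+ 4 * ri ^+ 3 * (t ^+ 4 / 2)); last by field.
rewrite e1 e2 -subr_ge0 (_ : _ - _ = r * t / 2 * (t ^+ 3 - 4 * t + 4)); last by field.
apply: mulr_ge0; first by rewrite divr_ge0 // mulr_ge0 // ltW.
(* the minimum over t >= 0 is near 6 / 5 *)
have : 0 <= (t - 6 / 5) ^+ 2 * (t + 12 / 5).
  by rewrite mulr_ge0 ?sqr_ge0 //; lra.
lra.
Qed.

(** Concavity bounds w ^ beta by its tangent at w = n, and E w is linear in n. *)
Lemma mean_corner_fun_le (R : realType) (rho C beta : R) n a :
  0 <= rho <= 1 -> 0 < C -> 0 <= beta <= 1 -> (0 < n)%N ->
  walk_mean rho n a (corner_fun C beta) <= (C + 4) * n%:R `^ beta.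
Proof.
move=> r01 C0 b01 n0.
have n1 : 1 <= n%:R :> R by rewrite ler1n.
have nb := powR_ge0 (n%:R : R) beta; set N := n%:R `^ beta in nb *.
have h := mean_sqr_height_le n a r01.
apply: le_trans (_ : walk_mean rho n a (fun z z' =>
   (N / n%:R) * (height R z ^+ 2 + height R z' ^+ 2) + N * (1 + C / n%:R)) <= _).
  apply: walk_mean_le => // z z'.
  rewrite /corner_fun /quad_pow.
  have x2 := sqr_ge0 (height R z); have y2 := sqr_ge0 (height R z').
  set w := C + _ + _; have w0 : 0 < w by rewrite /w; lra.
  have wn0 : 0 < w / n%:R by rewrite divr_gt0 //; lra.
  have -> : w = n%:R * (w / n%:R) by rewrite mulrC mulfVK // gt_eqF //; lra.
  rewrite powRM ?ler0n ?(ltW wn0) // -/N.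
  apply: le_trans (_ : N * (1 + w / n%:R) <= _); last by rewrite /w; lra.
  apply: ler_wpM2l => //; have := powR_bernoulli b01 wn0.
  have : beta * (w / n%:R - 1) <= w / n%:R by case/andP: b01 => *; nra.
  lra.
rewrite walk_meanD walk_meanZ walk_mean_cst //.
have iv : n%:R^-1 <= 1 :> R by rewrite invf_le1 //; lra.
have iv0 : 0 < n%:R^-1 :> R by rewrite invr_gt0; lra.
have nv : n%:R * n%:R^-1 = 1 :> R by rewrite divff // gt_eqF //; lra.
apply: le_trans (_ : N / n%:R * (2 * n%:R + 2^-1) + N * (1 + C / n%:R) <= _).
  by rewrite lerD2r ler_wpM2l // divr_ge0.
have -> : N / n%:R * (2 * n%:R + 2^-1) + N * (1 + C / n%:R) =
   N * (1 + 2 * (n%:R * n%:R^-1) + (2^-1 + C) * n%:R^-1).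
  by ring.
by rewrite [leRHS]mulrC; apply: ler_wpM2l => //; rewrite nv; nra.
Qed.

(** * Noise and the Fourier-Walsh expansion *)

Lemma normc_sqrE (R : realType) (x : R[i]) :
  (Normc.normc x ^+ 2)%:C = x * conjc x.
Proof. by rewrite rmorphXn -sqr_normc. Qed.

Lemma conj_walsh (R : realType) n (A : {set 'I_n}) (s : n.-tuple bool) :
  conjc (walsh R A s) = walsh R A s.
Proof.
rewrite /walsh rmorph_prod; apply: eq_bigr => i _.
by rewrite rmorphXn rmorphN rmorph1.
Qed.

Lemma walsh_set0 (R : realType) n (s : n.-tuple bool) : walsh R finset.set0 s = 1.
Proof. by rewrite /walsh big_set0. Qed.

Definition flip n (i : 'I_n) (s : n.-tuple bool) : n.-tuple bool :=
  [tuple tnth s j (+) (j == i) | j < n].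

Lemma flipK n (i : 'I_n) : involutive (flip i).
Proof.
by move=> s; apply: eq_from_tnth => j; rewrite !tnth_mktuple addbK.
Qed.

Lemma walsh_flip (R : realType) n (A : {set 'I_n}) (i : 'I_n) (s : n.-tuple bool) :
  walsh R A (flip i s) = (-1) ^+ (i \in A) * walsh R A s.
Proof.
rewrite /walsh; under eq_bigr do rewrite tnth_mktuple signr_addb mulrC.
rewrite big_split; congr (_ * _).
have [iA|iA] := boolP (i \in A).
  rewrite (bigD1 i) //= eqxx big1 ?mulr1 // => j /andP[_ /negPf ->].
  by rewrite expr0.
rewrite big1 // => j jA; case: eqP => [ji|]; last by rewrite expr0.
by rewrite -ji jA in iA.
Qed.

(** Flipping a coordinate that belongs to exactly one of A and B changes the sign of
the product. *)
Lemma walsh_orthogonal (R : realType) n (A B : {set 'I_n}) :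
  \sum_(s : n.-tuple bool) walsh R A s * walsh R B s = 2 ^+ n *+ (A == B).
Proof.
have [<-|AB] := eqVneq A B.
  rewrite (eq_bigr (fun=> 1)) => [|s _].
    by rewrite sumr_const card_tuple card_bool natrX.
  rewrite /walsh -big_split big1 // => i _ /=.
  by rewrite -signr_addb addbb.
have [i iAB] : exists i, (i \in A) (+) (i \in B).
  apply/existsP; apply: contraNT AB; rewrite negb_exists => /forallP h.
  by apply/eqP/finset.setP => i; apply/eqP; rewrite -negb_add.
set S := \sum_s _.
suff : S = - S by move/eqP; rewrite -addr_eq0 -mulr2n mulrn_eq0 /= => /eqP.
rewrite {1}/S (reindex_inj (inv_inj (flipK i))) -sumrN.
apply: eq_bigr => s _; rewrite !walsh_flip mulrACA -signr_addb iAB expr1 mulN1r.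
by [].
Qed.

(** The weight is the product of the factors (1 + rho s_i t_i) / 4; expanding it over
the sets A of indices for which the second term is chosen gives the sum. *)
Lemma noise_weight_walsh (R : realType) (rho : R) n (s t : n.-tuple bool) :
  (noise_weight rho s t)%:C =
  (2 ^+ n)^-1 * (2 ^+ n)^-1 *
    \sum_(A : {set 'I_n}) (rho ^+ #|A|)%:C * (walsh R A s * walsh R A t).
Proof.
rewrite /noise_weight big_split /= prodr_const card_ord rmorphM mulrC.
congr (_ * _).
  rewrite rmorphXn fmorphV rmorph_nat -exprVn -exprMn; congr (_ ^+ n).
  by field.
transitivity (\prod_(i < n) (1 + rho%:C * (-1) ^+ (tnth s i (+) tnth t i))).
  rewrite rmorph_prod; apply: eq_bigr => i _.
  by rewrite rmorphD rmorph1 rmorphM rmorphXn rmorphN rmorph1.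
under [LHS]eq_bigr do rewrite addrC.
rewrite bigA_distr; apply: eq_big => [A|A _]; first by rewrite inE.
rewrite -big_mkcond big_split /= prodr_const rmorphXn; congr (_ * _).
rewrite /walsh -big_split /=.
by apply: eq_bigr => i _; rewrite signr_addb.
Qed.

(** The noise operator is diagonal in the Walsh basis. *)
Lemma noise_sum_fourier (R : realType) (rho : R) n (f g : n.-tuple bool -> R[i]) :
  \sum_(s : n.-tuple bool) \sum_(t : n.-tuple bool)
    (noise_weight rho s t)%:C * (f s * conjc (g t)) =
  \sum_(A : {set 'I_n}) (rho ^+ #|A|)%:C * (fourier f A * conjc (fourier g A)).
Proof.
have JM (x y : R[i]) : conjc (x * y) = conjc x * conjc y by exact: rmorphM.
have c2 : conjc ((2 ^+ n)^-1) = (2 ^+ n)^-1 :> R[i].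
  by rewrite conjc_inv -natrX conjc_nat.
transitivity (\sum_(s : n.-tuple bool) \sum_(t : n.-tuple bool)
   \sum_(A : {set 'I_n}) (rho ^+ #|A|)%:C *
     (((2 ^+ n)^-1 * (f s * walsh R A s)) * conjc ((2 ^+ n)^-1 * (g t * walsh R A t)))).
  apply: eq_bigr => s _; apply: eq_bigr => t _.
  rewrite noise_weight_walsh !mulr_sumr mulr_suml; apply: eq_bigr => A _.
  rewrite !JM conj_walsh c2.
  ring.
under eq_bigr do rewrite exchange_big.
rewrite exchange_big; apply: eq_bigr => A _.
under eq_bigr do rewrite -mulr_sumr -mulr_sumr.
rewrite -mulr_sumr -mulr_suml; congr (_ * (_ * _)).
  by rewrite /fourier mulr_sumr.
by rewrite /fourier mulr_sumr rmorph_sum.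
Qed.

Lemma fourier1 (R : realType) n (A : {set 'I_n}) :
  fourier (fun=> 1 : R[i]) A = (A == finset.set0)%:R.
Proof.
rewrite /fourier (eq_bigr (fun s => walsh R A s * walsh R finset.set0 s)); last first.
  by move=> s _; rewrite walsh_set0 mulr1 mul1r.
rewrite walsh_orthogonal; case: (A == finset.set0); last by rewrite mulr0n mulr0.
by rewrite mulVf // expf_neq0 // pnatr_eq0.
Qed.

Definition energy (R : realType) n (f : n.-tuple bool -> R[i]) (A : {set 'I_n}) : R :=
  Normc.normc (fourier f A) ^+ 2.

Lemma energy_ge0 (R : realType) n (f : n.-tuple bool -> R[i]) A : 0 <= energy f A.
Proof. exact: sqr_ge0. Qed.

Lemma cube_norm_sqr (R : realType) n (f : n.-tuple bool -> R[i]) :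
  cube_norm f ^+ 2 = (2 ^+ n)^-1 * \sum_(s : n.-tuple bool) Normc.normc (f s) ^+ 2.
Proof.
rewrite sqr_sqrtr // mulr_ge0 ?invr_ge0 ?exprn_ge0 // sumr_ge0 // => s _.
exact: sqr_ge0.
Qed.

Lemma cube_norm_sqrC (R : realType) n (f : n.-tuple bool -> R[i]) :
  (cube_norm f ^+ 2)%:C = (2 ^+ n)^-1 * \sum_(s : n.-tuple bool) f s * conjc (f s).
Proof.
rewrite cube_norm_sqr rmorphM fmorphV rmorphXn rmorph_nat rmorph_sum.
by congr (_ * _); apply: eq_bigr => s _; rewrite /= normc_sqrE.
Qed.

(** At rho = 1 the two points of the cube coincide. *)
Lemma parseval (R : realType) n (f : n.-tuple bool -> R[i]) :
  cube_norm f ^+ 2 = \sum_(A : {set 'I_n}) energy f A.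
Proof.
apply: (@complexI R); rewrite cube_norm_sqrC rmorph_sum /=.
under [RHS]eq_bigr do rewrite normc_sqrE.
transitivity (\sum_(A : {set 'I_n}) (1 ^+ #|A|)%:C * (fourier f A * conjc (fourier f A))).
  rewrite -noise_sum_fourier mulr_sumr; apply: eq_bigr => s _.
  rewrite (bigD1 s) //= [X in _ + X]big1 => [|t ts].
    rewrite addr0; congr (_ * _); rewrite noise_weight_walsh.
    under eq_bigr do rewrite expr1n mul1r.
    by rewrite sum_walsh eqxx mulfVK // expf_neq0 // pnatr_eq0.
  rewrite noise_weight_walsh; under eq_bigr do rewrite expr1n mul1r.
  by rewrite sum_walsh eq_sym (negPf ts) mulr0n mulr0 mul0r.
by apply: eq_bigr => A _; rewrite expr1n mul1r.
Qed.

Lemma cube_norm_degree_part (R : realType) n (f : n.-tuple bool -> R[i]) j :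
  cube_norm (degree_part f j) ^+ 2 = \sum_(A : {set 'I_n} | #|A| == j) energy f A.
Proof.
rewrite parseval [RHS]big_mkcond; apply: eq_bigr => A _; rewrite /energy.
suff -> : fourier (degree_part f j) A = if #|A| == j then fourier f A else 0.
  by case: ifP => //; rewrite Normc.normc0 expr0n.
rewrite {1}/fourier /degree_part.
under eq_bigr do rewrite mulr_suml.
rewrite exchange_big /=.
under eq_bigr do (under eq_bigr do rewrite -mulrA; rewrite -mulr_sumr walsh_orthogonal).
rewrite big_mkcond (bigD1 A) //= [X in _ + X]big1 => [|B /negPf ->]; last first.
  by rewrite mulr0n mulr0; case: ifP.
rewrite addr0 eqxx; case: ifP => _; last by rewrite mulr0.
by rewrite mulrCA mulVf ?mulr1 // expf_neq0 // pnatr_eq0.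
Qed.

Lemma spectral_tailE (R : realType) n m (f : n.-tuple bool -> R[i]) :
  spectral_tail m f = \sum_(A : {set 'I_n} | (m <= #|A|)%N) energy f A.
Proof.
have cardP (A : {set 'I_n}) : (#|A| < n.+1)%N.
  by rewrite ltnS -[X in (_ <= X)%N]card_ord max_card.
rewrite /spectral_tail big_geq_mkord.
rewrite [RHS](partition_big (fun A : {set 'I_n} => inord #|A| : 'I_n.+1)
  (fun j : 'I_n.+1 => (m <= j)%N)) /=; last first.
  by move=> A mA; rewrite inordK.
apply: eq_bigr => j mj; rewrite cube_norm_degree_part; apply: eq_bigl => A.
by rewrite -val_eqE /= inordK //; case: eqP => [->|]; rewrite ?mj // andbF.
Qed.

(** The terms |f(s)|^2 and |f(t)|^2 of the expanded square are paired with the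
constant 1, whose only Fourier coefficient is that of the empty set. *)
Lemma noise_mean_sqr_dist (R : realType) (rho : R) n (f : n.-tuple bool -> R[i]) :
  noise_mean rho (fun s t => Normc.normc (f s - f t) ^+ 2) =
  2 * \sum_(A : {set 'I_n}) (1 - rho ^+ #|A|) * energy f A.
Proof.
apply: (@complexI R); rewrite /noise_mean rmorph_sum.
under eq_bigr do rewrite rmorph_sum.
pose W (s t : n.-tuple bool) := (noise_weight rho s t)%:C.
pose g s := f s * conjc (f s).
have gJ s : conjc (g s) = g s by rewrite /g rmorphM /= conjcK mulrC.
transitivity (\sum_(s : n.-tuple bool) \sum_(t : n.-tuple bool)
   ((W s t * (g s * conjc 1) + W s t * (1 * conjc (g t))) -
    (W s t * (f s * conjc (f t)) + W s t * (f t * conjc (f s))))).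
  apply: eq_bigr => s _; apply: eq_bigr => t _.
  rewrite conjc1 rmorphM /= normc_sqrE gJ rmorphB /g /W; ring.
have WC s t : W s t = W t s.
  rewrite /W /noise_weight; congr (_%:C); apply: eq_bigr => i _.
  by rewrite addbC.
have split2 (F G : n.-tuple bool -> n.-tuple bool -> R[i]) :
    \sum_s \sum_t (F s t + G s t) = \sum_s \sum_t F s t + \sum_s \sum_t G s t.
  by rewrite -big_split; apply: eq_bigr => s _; rewrite big_split.
rewrite split2; under [X in _ + X]eq_bigr do rewrite sumrN.
rewrite sumrN !split2 !noise_sum_fourier.
have -> : \sum_s \sum_t W s t * (f t * conjc (f s)) =
          \sum_s \sum_t W s t * (f s * conjc (f t)).
  rewrite exchange_big; apply: eq_bigr => s _; apply: eq_bigr => t _.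
  by rewrite WC.
rewrite noise_sum_fourier.
have gA : fourier g finset.set0 = (\sum_A energy f A)%:C.
  rewrite -parseval cube_norm_sqrC /fourier; congr (_ * _).
  by apply: eq_bigr => s _; rewrite walsh_set0 mulr1.
have e1 : \sum_(A : {set 'I_n}) (rho ^+ #|A|)%:C *
    (fourier g A * conjc (fourier (fun=> 1 : R[i]) A)) = (\sum_A energy f A)%:C.
  rewrite (bigD1 finset.set0) //= big1 => [|A /negPf A0].
    by rewrite fourier1 eqxx rmorph1 cards0 expr0 mul1r mulr1 addr0 gA.
  by rewrite fourier1 A0 rmorph0 !mulr0.
have e2 : \sum_(A : {set 'I_n}) (rho ^+ #|A|)%:C *
    (fourier (fun=> 1 : R[i]) A * conjc (fourier g A)) = (\sum_A energy f A)%:C.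
  rewrite (bigD1 finset.set0) //= big1 => [|A /negPf A0].
    by rewrite fourier1 eqxx cards0 expr0 !mul1r addr0 gA conjc_real.
  by rewrite fourier1 A0 mul0r mulr0.
rewrite e1 e2.
have -> : \sum_(A : {set 'I_n}) (rho ^+ #|A|)%:C * (fourier f A * conjc (fourier f A))
  = (\sum_(A : {set 'I_n}) rho ^+ #|A| * energy f A)%:C.
  rewrite rmorph_sum; apply: eq_bigr => A _.
  by rewrite -normc_sqrE -rmorphM.
rewrite -!rmorphD -rmorphB; congr (_%:C).
under [in RHS]eq_bigr do rewrite mulrBl mul1r.
by rewrite sumrB; ring.
Qed.

(** In degree k < m, the factor 1 - rho ^ k is at most m (1 - rho). *)
Lemma noise_mean_sqr_dist_le (R : realType) (rho : R) n m (f : n.-tuple bool -> R[i]) :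
  0 <= rho <= 1 ->
  noise_mean rho (fun s t => Normc.normc (f s - f t) ^+ 2) <=
  2 * m%:R * (1 - rho) * cube_norm f ^+ 2 + 2 * spectral_tail m f.
Proof.
move=> /andP[r0 r1]; rewrite noise_mean_sqr_dist spectral_tailE parseval -!mulrA -mulrDr.
rewrite ler_pM2l // mulrA mulr_sumr [X in _ <= _ + X]big_mkcond -big_split /=.
apply: ler_sum => A _; have q0 := energy_ge0 f A.
have m0 : 0 <= m%:R * (1 - rho) by rewrite mulr_ge0 // subr_ge0.
have rA0 : 0 <= rho ^+ #|A| by rewrite exprn_ge0.
case: leqP => [_|Am].
  have : 0 <= m%:R * (1 - rho) * energy f A by rewrite mulr_ge0.
  have : (1 - rho ^+ #|A|) * energy f A <= 1 * energy f A.
    by rewrite ler_wpM2r // lerBlDr lerDl.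
  lra.
rewrite addr0 ler_wpM2r //.
have bern k : 1 - rho ^+ k <= k%:R * (1 - rho).
  elim: k => [|k IH]; first by rewrite expr0 mul0r subrr.
  have k1 : rho ^+ k <= 1 by rewrite exprn_ile1.
  by rewrite exprS -natr1; nra.
apply: le_trans (bern _) _; rewrite ler_wpM2r ?subr_ge0 // ler_nat ltnW //.
Qed.

(** * Two coupled walks are far apart *)

(** The sum of the separation, minus the two heights, plus a multiple of the corner
function is a submartingale. A height has drift 1/2 in the triangle and 0
elsewhere, so it measures the visits to the triangle; the loss of the separation
at common visits is compensated by the corner function. *)
Lemma mean_separation_ge (R : realType) (rho : R) : 0 < rho < 1 ->
  exists C beta K : R, [/\ 0 < C, 0 < beta < 2^-1, 0 < K & forall n a,
    walk_mean rho n a (fun z z' => height R z + height R z') - 1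
      - K * walk_mean rho n a (corner_fun C beta) <=
    walk_mean rho n a (fun z z' => (separation z z')%:R)].
Proof.
move=> r01; have [C [beta [kappa [C0 b0 k0 drift]]]] := corner_fun_exists r01.
exists C, beta, (11 / kappa); split=> // [|n a]; first exact: divr_gt0.
have r01' : 0 <= rho <= 1 by lra.
pose Phi z z' : R := (separation z z')%:R +
  (- 1 * (height R z + height R z') + 11 / kappa * corner_fun C beta z z').
have := @submartingale_walk_mean R rho n a (fun _ => Phi) r01'.
move=> h; rewrite walk_meanD walk_meanD !walk_meanZ in h.
have Phi0 : - 1 <= Phi origin origin.
  have : 0 <= 11 / kappa * corner_fun C beta origin origin.
    by rewrite mulr_ge0 ?powR_ge0 // divr_ge0 // ltW.
  have := ler0n R (separation origin origin).
  rewrite /Phi /height /=; lra.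
suff sub : forall (m : nat) c z z', - rho <= c <= rho ->
    Phi z z' <= step_mean c Phi z z'.
  by have := le_trans Phi0 (h sub); lra.
move=> _ c z z' crho.
set X : R := (central z && central z')%:R.
set S : R := (central z)%:R + (central z')%:R.
have sep b : 2 * (separation z z')%:R + S - 22 * X <=
    (separation (state_step z false) (state_step z' b))%:R +
    (separation (state_step z true) (state_step z' (~~ b)))%:R.
  move: (separation_drift z z' b); rewrite /X /S.
  move: (separation _ _) (separation _ _) (separation _ _) => d0 d1 d2.
  rewrite -(ler_nat R) !(natrD, natrM); lra.
have ht y : height R (state_step y false) + height R (state_step y true) =
    2 * height R y + (central y)%:R.
  by case: y => j [|k]; rewrite /height /central /= -?natr1; field.
have h1 := ht z; have h2 := ht z'.
have {drift} := drift c z z' crho; rewrite -/X => dr.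
have {}dr : 11 / kappa * (corner_fun C beta z z' + kappa * X) <=
    11 / kappa * step_mean c (corner_fun C beta) z z'.
  by rewrite ler_pM2l // divr_gt0.
have {}dr : 11 / kappa * corner_fun C beta z z' + 11 * X <=
    11 / kappa * step_mean c (corner_fun C beta) z z'.
  by apply: le_trans dr; rewrite mulrDr mulrA mulfVK // lt0r_neq0.
have p0 : 0 <= (1 + c) / 4 by lra.
have q0 : 0 <= (1 - c) / 4 by lra.
have s1 := ler_wpM2l p0 (sep false); have s2 := ler_wpM2l q0 (sep true).
rewrite /= in s1 s2.
have -> : step_mean c Phi z z' =
   step_mean c (fun z z' => (separation z z')%:R) z z'
   - step_mean c (fun z z' => height R z + height R z') z z'
   + 11 / kappa * step_mean c (corner_fun C beta) z z'.
  by rewrite /step_mean /Phi; ring.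
have e2 := step_mean_add c (@height R) z z'; rewrite h1 h2 in e2; rewrite e2.
have s3 : (separation z z')%:R + S / 2 - 11 * X <=
    step_mean c (fun z z' => (separation z z')%:R) z z'.
  rewrite /step_mean; lra.
move: s3 dr; rewrite /Phi /S; clear; lra.
Qed.

Lemma powR_le_sqrt (R : realType) (beta K : R) : 0 < beta < 2^-1 -> 0 < K ->
  exists N, forall n, (N <= n)%N -> K * n%:R `^ beta <= Num.sqrt n%:R.
Proof.
move=> /andP[b0 b1] K0.
set e := 2^-1 - beta; have e0 : 0 < e by rewrite /e; lra.
exists (Num.bound (K `^ e^-1)).+1 => n nN.
have n0 : 0 < n%:R :> R by rewrite ltr0n (leq_trans _ nN).
have Kn : K <= n%:R `^ e.
  have -> : K = (K `^ e^-1) `^ e by rewrite -powRrM mulVf ?gt_eqF // powRr1 // ltW.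
  apply: ge0_ler_powR; rewrite ?nnegrE ?powR_ge0 ?ltW //.
  apply: lt_le_trans (archi_boundP (powR_ge0 _ _)) _.
  by rewrite ler_nat ltnW.
rewrite -powR12_sqrt ?(ltW n0) // (_ : 2^-1 = e + beta); last by rewrite /e; ring.
rewrite powRD ?(gt_eqF n0) ?implybT //.
by rewrite ler_wpM2r // powR_ge0.
Qed.

(** The separation is at most 7 dist + 3, and its mean is at least
(4/5) sqrt n - o(sqrt n). Bounding dist by
5 dist^2 / r + r / 20 with r = sqrt n costs (7/20) sqrt n and leaves a positive
multiple of sqrt n below a multiple of E dist^2 / sqrt n. *)
Lemma mean_sqr_dist_ge (R : realType) (rho : R) : 0 < rho < 1 ->
  exists N, forall n a, (N <= n)%N ->
    n%:R / 400 <= walk_mean rho n a (fun z z' =>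
      Normc.normc (state_point R z - state_point R z') ^+ 2).
Proof.
move=> r01; have [C [beta [K [C0 b0 K0 sep]]]] := mean_separation_ge r01.
have r01' : 0 <= rho <= 1 by lra.
have K1 : 0 < 10 * (K * (C + 4) + 4) by have := mulr_gt0 K0 C0; lra.
have [N NP] := powR_le_sqrt b0 K1.
exists N.+1 => n a Nn; have n0 : (0 < n)%N by exact: leq_trans Nn.
have n1 : 1 <= n%:R :> R by rewrite ler1n.
set r := Num.sqrt (n%:R : R).
have rn : r ^+ 2 = n%:R by rewrite sqr_sqrtr // ler0n.
have r1 : 1 <= r by rewrite -sqrtr1 ler_wsqrtr.
have r0 : 0 < r by lra.
have nb1 : 1 <= n%:R `^ beta :> R.
  have b00 : 0 <= beta by lra.
  by have := ler_powR n1 b00; rewrite powRr0.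
have big := NP n (ltnW Nn); rewrite -/r in big.
have hh := mean_height_ge a r01' r1 rn.
have b01 : 0 <= beta <= 1 by lra.
have cc := mean_corner_fun_le a r01' C0 b01 n0.
have {}sep := sep n a.
have {}cc := ler_wpM2l (ltW K0) cc.
set M := walk_mean rho n a _.
have up : walk_mean rho n a (fun z z' => (separation z z')%:R) <=
   140 / 3 / r * M + (7 / 20 * r + 3).
  rewrite -walk_meanZ -[X in _ + X](walk_mean_cst _ n a r01') -walk_meanD.
  apply: walk_mean_le => // z z'.
  have d2 := graph_dist_le_norm R z z'.
  set D := Normc.normc _ ^+ 2 in d2 *; set d : R := (graph_dist z z')%:R in d2 *.
  have bl : (bonus z z')%:R <= 3 :> R by rewrite (ler_nat _ _ 3) bonus_le.
  rewrite /separation natrD natrM -/d.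
  have : 0 <= (d - r / 10) ^+ 2 by exact: sqr_ge0.
  have -> : 140 / 3 / r * D = 35 / r * (4 / 3 * D) by field; exact: lt0r_neq0.
  have ri0 : 0 < 35 / r by rewrite divr_gt0.
  have := ler_wpM2l (ltW ri0) d2 => h1 h2.
  have h3 : 7 * d <= 35 / r * d ^+ 2 + 7 / 20 * r.
    have e : 35 / r * (d - r / 10) ^+ 2 = 35 / r * d ^+ 2 - 7 * d + 7 / 20 * r.
      by field; exact: lt0r_neq0.
    have : 0 <= 35 / r * (d - r / 10) ^+ 2 by rewrite mulr_ge0 // ltW.
    lra.
  lra.
have low : 7 / 20 * r <= 140 / 3 / r * M.
  have e1 : 4 <= 4 * n%:R `^ beta :> R by lra.
  lra.
have : 7 / 20 * r * r <= 140 / 3 / r * M * r by rewrite ler_pM2r.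
have -> : 140 / 3 / r * M * r = 140 / 3 * M by field; exact: lt0r_neq0.
by rewrite -mulrA -expr2 rn; lra.
Qed.

(** * Contradiction with cube stability *)

Lemma limn_esup_lt (R : realType) (u : (\bar R)^nat) (l : \bar R) :
  (limn_esup u < l)%E -> exists M : \bar R, (M < l)%E /\
    exists N, forall n, (N <= n)%N -> (u n <= M)%E.
Proof.
move=> /ereal_inf_lt[_ /= [V [N _ NV] <-] Vl].
exists (ereal_sup (u @` V)); split=> //; exists N => n Nn.
by apply: ereal_sup_ubound; exists n => //; apply: NV.
Qed.

Lemma cube_stable_bounds (R : realType) (f : forall n, n.-tuple bool -> R[i]) (e : R) :
    cube_stable f -> 0 < e ->
  exists (B : R) m N, 0 < B /\ forall n, (N <= n)%N ->
    cube_norm (f n) ^+ 2 <= B /\ spectral_tail m (f n) < e.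
Proof.
move=> [_ bnd tail] e0.
have [M [Moo [N1 NM]]] := limn_esup_lt bnd.
have [m _ /(_ m (leqnn m)) me] : \forall m \near \oo,
    (limn_esup (fun n => (spectral_tail m (f n))%:E) < e%:E)%E.
  exact: (tail _ (nbhs_open_ereal_lt (f := fun=> e) e0)).
have [M' [Me [N2 NM']]] := limn_esup_lt me.
exists ((fine M) ^+ 2 + 1), m, (maxn N1 N2); split.
  by have := sqr_ge0 (fine M); lra.
move=> n; rewrite geq_max => /andP[n1 n2]; split; last first.
  by rewrite -lte_fin; exact: le_lt_trans (NM' n n2) Me.
have c0 : 0 <= cube_norm (f n) := sqrtr_ge0 _.
have cM : cube_norm (f n) <= fine M.
  by case: (M) Moo (NM n n1) => [x||] //=; rewrite lee_fin.
suff : cube_norm (f n) ^+ 2 <= fine M ^+ 2 by lra.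
by rewrite ler_sqr ?nnegrE // (le_trans c0).
Qed.

Theorem mainTheorem3 (R : realType) :
  ~ tree_stable (fun (n : nat) (tau : n.-tuple bool) =>
      spider_walk R tau / (Num.sqrt (n%:R : R))%:C).
Proof.
move=> [A [autA stableA]]; set f := fun n => _ in stableA.
have [|B [m [N1 [B0 bnd]]]] := cube_stable_bounds (e := 1 / 2000) stableA.
  by lra.
have mB0 : 0 <= m%:R * B by rewrite mulr_ge0 // ltW.
(* the noise level 1 - rho = d is chosen after m and B *)
set d := (2000 * (m%:R * B + 1))^-1.
have d0 : 0 < d by rewrite invr_gt0; lra.
have d1 : d < 1 by rewrite invf_lt1; lra.
have dB : d * (m%:R * B + 1) = 1 / 2000 by rewrite /d; field; lra.
have rho01 : 0 < 1 - d < 1 by lra.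
have [N2 far] := mean_sqr_dist_ge rho01.
set n := (maxn N1 N2).+1.
have n1 : (N1 <= n)%N by rewrite leqW // leq_maxl.
have n2 : (N2 <= n)%N by rewrite leqW // leq_maxr.
have [norm_n tail_n] := bnd n n1.
have [a Aa] := tree_automorphism_twist (autA n).
have r01 : 0 <= 1 - d <= 1 by lra.
have near_f := noise_mean_sqr_dist_le m (f n) r01.
have n0 : 0 < n%:R :> R by rewrite ltr0n.
have sqr_norm_sqrt : Normc.normc (Num.sqrt (n%:R : R))%:C ^+ 2 = n%:R.
  by rewrite /Normc.normc /= expr0n addr0 !sqr_sqrtr ?sqr_ge0 // ler0n.
have distE s t : n%:R * Normc.normc (f n s - f n t) ^+ 2 =
    Normc.normc (state_point R (foldl state_step origin (twist a s)) -
                 state_point R (foldl state_step origin (twist a t))) ^+ 2.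
  have o : 0 = state_point R origin.
    by rewrite /state_point /spider_point /spider_vertex /= mul0r addr0.
  rewrite /f /= /spider_walk !Aa o !foldl_state_point -mulrBl Normc.normcM Normc.normcV.
  rewrite exprMn exprVn sqr_norm_sqrt mulrCA divff ?mulr1 //.
  by rewrite gt_eqF.
have := far n a n2; rewrite /walk_mean.
have -> : noise_mean (1 - d) (fun s t : n.-tuple bool => Normc.normc
    (state_point R (foldl state_step origin (twist a s)) -
     state_point R (foldl state_step origin (twist a t))) ^+ 2) =
   n%:R * noise_mean (1 - d) (fun s t => Normc.normc (f n s - f n t) ^+ 2).
  by rewrite -noise_meanZ; congr noise_mean; apply/funext => s; apply/funext => t;
    rewrite distE.
rewrite ler_pM2l // => lower.
have dm0 : 0 <= 2 * m%:R * d by rewrite !mulr_ge0 // ltW.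
have := ler_wpM2l dm0 norm_n => upper.
have {}near_f := le_trans lower near_f.
rewrite /= in near_f.
lra.
Qed.
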